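(* Let $X$ be a completely regular Hausdorff space. A proper ideal $I$ of $C(X)$ is a $z^\circ$-ideal if and only if there exists an ideal $\mathcal{P}$ of closed sets in $X$ such that $I=C_{\mathcal{P}}(X)$.
   Context: $C(X)$ is the ring of all real-valued continuous functions on $X$; $Z(f)=\{x\in X: f(x)=0\}$. An ideal of closed sets in $X$ is a family $\mathcal{P}$ of closed subsets of $X$ such that (i) $A,B\in\mathcal{P}$ implies $A\cup B\in\mathcal{P}$, and (ii) $A\in\mathcal{P}$, $B\subseteq A$ with $B$ closed in $X$ implies $B\in\mathcal{P}$. $C_{\mathcal{P}}(X)=\{f\in C(X): \mathrm{cl}_X(X\setminus Z(f))\in\mathcal{P}\}$. For an element $a$ of a commutative ring $R$ with identity, $P_a$ denotes the intersection of all minimal prime ideals of $R$ containing $a$ (with $P_a=R$ if there are none). An ideal $I$ of $R$ is a $z^\circ$-ideal if $P_a\subseteq I$ for each $a\in I$. *)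

(* Defs.v *)
From HB Require Import structures.
From mathcomp Require Import all_boot all_order all_algebra.
From mathcomp Require Import all_classical all_reals all_analysis.

Set Implicit Arguments.
Unset Strict Implicit.
Unset Printing Implicit Defensive.

Import Order.TTheory GRing.Theory Num.Theory.
Import numFieldNormedType.Exports.

Local Open Scope classical_set_scope.
Local Open Scope ring_scope.

(* C(X): [continuousType X R] as a subring of the ring [X -> R] of all
   functions, with pointwise operations. [X] may be empty, in which case C(X)
   is the zero ring; hence [comPzRingType] rather than [comNzRingType]. *)
Section ContinuousRing.
Context (X : topologicalType) (R : realType).

Definition cts_pred : {pred X -> R} := mem [set f | continuous f].

Section Sub.
Context (f : X -> R) (fP : f \in cts_pred).
Definition cts_Sub_subproof := @isContinuous.Build X R f (set_mem fP).
#[local] HB.instance Definition _ := cts_Sub_subproof.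
Definition cts_Sub : continuousType X R := f.
End Sub.

Lemma cts_rect (K : continuousType X R -> Type) :
  (forall f (fP : f \in cts_pred), K (cts_Sub fP)) -> forall u, K u.
Proof.
move=> Ksub [f [[fc]]]/=.
suff -> : fc = set_mem (@mem_set _ [set f | continuous f] f fc) by exact: Ksub.
exact: Prop_irrelevance.
Qed.

Lemma cts_valP f (fP : f \in cts_pred) : cts_Sub fP = f :> (X -> R).
Proof. by []. Qed.

HB.instance Definition _ := isSub.Build _ _ (continuousType X R) cts_rect cts_valP.

Lemma cts_subring_closed : subring_closed cts_pred.
Proof.
split=> [|f g|f g]; rewrite !inE /=.
- by move=> x; exact: cvg_cst.
- by move=> fc gc x; apply: (@continuousB _ _ _ f g); [exact: fc|exact: gc].
- by move=> fc gc x; apply: (@continuousM _ _ f g); [exact: fc|exact: gc].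
Qed.

HB.instance Definition _ := GRing.SubChoice_isSubComPzRing.Build
  (X -> R) cts_pred (continuousType X R) cts_subring_closed.

Lemma ctsD (f g : continuousType X R) : f + g = f \+ g :> (X -> R).
Proof. by []. Qed.

Lemma ctsM (f g : continuousType X R) : f * g = f \* g :> (X -> R).
Proof. by []. Qed.

Lemma cts0 : (0 : continuousType X R) = cst 0 :> (X -> R).
Proof. by []. Qed.

Lemma cts1 : (1 : continuousType X R) = cst 1 :> (X -> R).
Proof. by []. Qed.

End ContinuousRing.

(* [ring_quotient.idealr_closed] requires a nonzero ring and includes
   properness, so ideals are introduced here as sets. *)
Definition is_ideal (A : comPzRingType) (I : set A) : Prop :=
  [/\ I 0, forall x y, I x -> I y -> I (x + y)
        & forall a x, I x -> I (a * x)].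

Definition is_proper_ideal (A : comPzRingType) (I : set A) : Prop :=
  is_ideal I /\ I <> [set: A].

Definition is_prime_ideal (A : comPzRingType) (Q : set A) : Prop :=
  is_proper_ideal Q /\ forall x y, Q (x * y) -> Q x \/ Q y.

Definition is_minimal_prime (A : comPzRingType) (Q : set A) : Prop :=
  is_prime_ideal Q /\
  forall Q' : set A, is_prime_ideal Q' -> Q' `<=` Q -> Q' = Q.

(* P_a; the empty intersection is the whole ring. *)
Definition minimal_primes_meet (A : comPzRingType) (a : A) : set A :=
  \bigcap_(Q in [set Q : set A | is_minimal_prime Q /\ Q a]) Q.

Definition is_z_circ_ideal (A : comPzRingType) (I : set A) : Prop :=
  is_ideal I /\ forall a, I a -> minimal_primes_meet a `<=` I.

(* As in the usual definition, the empty family is not excluded. *)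
Definition is_closed_set_ideal (X : topologicalType) (P : set (set X)) : Prop :=
  [/\ forall A, P A -> closed A,
      forall A B, P A -> P B -> P (A `|` B)
    & forall A B, P A -> B `<=` A -> closed B -> P B].

Definition zero_set (X : topologicalType) (R : realType)
  (f : continuousType X R) : set X := [set x | f x = 0].

(* C_P(X) *)
Definition supported_in (X : topologicalType) (R : realType)
  (P : set (set X)) : set (continuousType X R) :=
  [set f | P (closure (~` zero_set f))].

(* Main.v *)
(* In a reduced ring, P_a consists of the b with Ann(a) contained in Ann(b). In
   C(X), for X completely regular, this inclusion of annihilators means that
   the support cl(X \ Z(b)) is contained in cl(X \ Z(a)). So the z-circ-ideals
   are the ideals that are downward closed for inclusion of supports, and the
   closed subsets of supports of members of I form the required family P; it is
   closed under unions because f^2 + g^2 has support cl(X \ Z(f)) u cl(X \ Z(g)). *)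
Require Import Defs.
From HB Require Import structures.
From mathcomp Require Import all_boot all_order all_algebra.
From mathcomp Require Import all_classical all_reals all_analysis.

Set Implicit Arguments.
Unset Strict Implicit.
Unset Printing Implicit Defensive.

Import Order.TTheory GRing.Theory Num.Theory.
Import numFieldNormedType.Exports.

Local Open Scope classical_set_scope.
Local Open Scope ring_scope.

Definition is_reduced (A : comPzRingType) : Prop :=
  forall (x : A) n, x ^+ n = 0 -> x = 0.

Definition is_mult_set (A : comPzRingType) (M : set A) : Prop :=
  M 1 /\ forall x y, M x -> M y -> M (x * y).

Section MinimalPrimes.
Context (A : comPzRingType).
Implicit Types (M N Q : set A) (a b h : A).

Lemma reduced_mulrXn_eq0 a h n : is_reduced A -> h * a ^+ n = 0 -> h * a = 0.
Proof.
(* The power [n.+1] of [h * a] has the factor [h * a ^+ n] even when [n = 0]. *)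
move=> redA ha0; apply: (redA _ n.+1).
by rewrite exprMn exprSr exprS mulrACA ha0 mulr0.
Qed.

Lemma mult_set_prime_setC Q : is_prime_ideal Q -> is_mult_set (~` Q).
Proof.
move=> [[[_ _ QM] Qproper] Qprime]; split=> [Q1|x y nQx nQy /Qprime[]//].
by apply: Qproper; apply/seteqP; split=> // x _; rewrite -(mulr1 x); exact: QM.
Qed.

Lemma mult_set_adjoin M a :
  is_mult_set M -> is_mult_set [set x | exists h n, M h /\ x = h * a ^+ n].
Proof.
move=> [M1 MM]; split; first by exists 1, 0%N; rewrite expr0 mulr1.
move=> _ _ [h [n [Mh ->]]] [k [m [Mk ->]]].
by exists (h * k), (n + m)%N; rewrite mulrACA exprD; split=> //; exact: MM.
Qed.

Lemma maximal_mult_set M : is_mult_set M -> ~ M 0 ->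
  exists N, [/\ M `<=` N, is_mult_set N, ~ N 0
    & forall N', is_mult_set N' -> ~ N' 0 -> N `<=` N' -> N' = N].
Proof.
move=> [M1 MM] nM0.
(* [Zorn_bigcup] also covers the empty chain, hence the union with [M]. *)
pose good N := is_mult_set (M `|` N) /\ ~ N 0.
have [F Fgood Ftot|N [[multN nN0] maxN]] := @Zorn_bigcup A good.
  split; last by move=> [N /Fgood[_ nN0] N0].
  split=> [|x y]; first by left.
  move=> [Mx|[N FN Nx]] [My|[N' FN' Ny]]; first by left; exact: MM.
  - have [[_ multN'] _] := Fgood _ FN'.
    by have [||?|?] := multN' x y; [left|right|left|right; exists N'].
  - have [[_ multN] _] := Fgood _ FN.
    by have [||?|?] := multN x y; [right|left|left|right; exists N].
  - have [NN'|N'N] := Ftot _ _ FN FN'.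
    + have [[_ multN'] _] := Fgood _ FN'.
      have [||?|?] := multN' x y; [right; exact: NN'|by right|by left|].
      by right; exists N'.
    + have [[_ multN] _] := Fgood _ FN.
      have [||?|?] := multN x y; [by right|right; exact: N'N|by left|].
      by right; exists N.
exists (M `|` N); split=> //; first by case.
move=> N' multN' nN'0 MNN'; apply/seteqP; split=> // x N'x; right.
(* An element of [N'] outside [N] would make [N'] a strictly larger good set, since [N'] absorbs
   [M]. *)
apply: contrapT => nNx; apply: (maxN N').
- by split=> [|/(_ _ N'x)//]; apply: subset_trans MNN'; right.
- by split=> //; rewrite (setUidPr _ _).2// => y My; apply: MNN'; left.
Qed.

(* The minimal prime is the complement of a maximal multiplicative set [N]
   containing [M]: by maximality, each element outside [N] is annihilated by
   an element of [N]. *)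
Lemma minimal_prime_disjoint M : is_reduced A -> is_mult_set M -> ~ M 0 ->
  exists Q, is_minimal_prime Q /\ M `<=` ~` Q.
Proof.
move=> redA multM nM0.
have [N [MN multN nN0 maxN]] := maximal_mult_set multM nM0.
have [N1 NM] := multN.
have annN a : ~ N a -> exists2 h, N h & h * a = 0.
  move=> nNa; apply: contrapT => nann; apply: nNa.
  have Na := mult_set_adjoin a multN.
  rewrite -(maxN _ Na); first by exists 1, 1%N; rewrite mul1r expr1.
    move=> [h [n [Nh /esym/(reduced_mulrXn_eq0 redA) ha0]]].
    by apply: nann; exists h.
  by move=> h Nh; exists h, 0%N; rewrite expr0 mulr1.
have NannF a h : N h -> h * a = 0 -> ~ N a.
  by move=> Nh ha0 Na; apply: nN0; rewrite -ha0; exact: NM.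
exists (~` N); split; last by rewrite setCK.
split; first split; first split; first split.
- exact: nN0.
- move=> x y /annN[h Nh hx0] /annN[k Nk ky0].
  apply: (NannF _ (h * k)); first exact: NM.
  by rewrite mulrDr mulrAC hx0 mul0r add0r -mulrA ky0 mulr0.
- by move=> a x /annN[h Nh hx0]; apply: (NannF _ h) => //; rewrite mulrCA hx0 mulr0.
- by move=> NT; have : [set: A] 1 by []; rewrite -NT; apply.
- move=> x y nNxy; apply: contrapT => /not_orP[/contrapT Nx /contrapT Ny].
  by apply: nNxy; exact: NM.
- move=> Q Qprime QN; rewrite -(maxN (~` Q)) ?setCK//.
  + exact: mult_set_prime_setC.
  + by move=> nQ0; apply: nQ0; case: Qprime => [[[]]].
  + by rewrite -[N]setCK; exact: subsetC.
Qed.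

(** Otherwise the products [h * a ^+ n] with [h] outside [Q] form a multiplicative set avoiding 0. A
    minimal prime disjoint from it lies inside [Q], so equals [Q] by minimality, yet it misses
    [a]. *)
Lemma minimal_prime_ann Q a : is_reduced A -> is_minimal_prime Q -> Q a ->
  exists2 h, ~ Q h & h * a = 0.
Proof.
move=> redA [Qprime Qmin] Qa; apply: contrapT => nann.
have := mult_set_adjoin a (mult_set_prime_setC Qprime).
move=> /(minimal_prime_disjoint redA)[|Q' [[Q'prime _] disjQ']].
  move=> [h [n [nQh /esym/(reduced_mulrXn_eq0 redA) ha0]]].
  by apply: nann; exists h.
apply: (disjQ' a).
  exists 1, 1%N; rewrite mul1r expr1; split=> //.
  exact: (mult_set_prime_setC Qprime).1.
rewrite (Qmin Q')// => x Q'x; apply: contrapT => nQx.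
by apply: (disjQ' x) => //; exists x, 0%N; rewrite expr0 mulr1.
Qed.

Lemma minimal_primes_meetP a b : is_reduced A ->
  minimal_primes_meet a b <-> forall h, h * a = 0 -> h * b = 0.
Proof.
move=> redA; split=> [ab h ha0|annab Q [Qmin Qa]]; last first.
  have [h nQh ha0] := minimal_prime_ann redA Qmin Qa.
  have [[[Q0 _ _] _] Qprime] := Qmin.1.
  by have [|/nQh|//] := Qprime h b; first by rewrite annab.
apply: contrapT => hb0.
(* Since [h * b] is not nilpotent, some minimal prime misses it. That prime contains [h * a = 0] but
   not [h], hence contains [a] and therefore [b], a contradiction. *)
pose M := [set x | exists n, x = (h * b) ^+ n].
have multM : is_mult_set M.
  split; first by exists 0%N; rewrite expr0.
  by move=> _ _ [n ->] [m ->]; exists (n + m)%N; rewrite exprD.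
have [|Q [Qmin disjQ]] := minimal_prime_disjoint redA multM.
  by move=> [n /esym/redA].
have nQhb : ~ Q (h * b) by apply: disjQ; exists 1%N; rewrite expr1.
have [[[Q0 _ QM] _] Qprime] := Qmin.1.
apply: nQhb; have [|Qh|Qa] := Qprime h a; first by rewrite ha0.
- by rewrite mulrC; exact: QM.
- by apply: QM; apply: ab.
Qed.

End MinimalPrimes.

Section ContinuousFunctions.
Context (X : topologicalType) (R : realType).
Implicit Types f g h : continuousType X R.

Definition support f : set X := closure (~` zero_set f).

Lemma cts_eqP f g : f = g <-> forall x, f x = g x.
Proof.
by split=> [->//|fg]; apply: val_inj; apply/funext => x; exact: fg.
Qed.

Lemma cts_reduced : is_reduced (continuousType X R).
Proof.
move=> f n fn0; apply/cts_eqP => x.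
have fnx m : (f ^+ m) x = f x ^+ m.
  by elim: m => [|m IHm]; rewrite ?expr0// !exprS ctsM /= IHm.
by have /eqP := fnx n; rewrite fn0 eq_sym expf_eq0 => /andP[_ /eqP].
Qed.

(** The zero set of [f] is closed and contains every point where [g] is nonzero, hence also their
    closure. *)
Lemma mul_eq0_support f g x : f * g = 0 -> support g x -> f x = 0.
Proof.
move=> fg0; suff : support g `<=` zero_set f by apply.
have zclosed : closed (zero_set f).
  have -> : zero_set f = f @^-1` [set 0] by [].
  by apply: closed_comp => [y _|]; [exact: cts_fun|exact: closed_eq].
rewrite /support [X in _ `<=` X]((closure_id _).1 zclosed).
apply: closure_subset => y /= gy0.
have /eqP : f y * g y = 0 by move/cts_eqP : fg0 => /(_ y); rewrite ctsM.
by rewrite mulf_eq0 => /orP[/eqP//|/eqP].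
Qed.

Lemma sub_support_ann f g h :
  support g `<=` support f -> h * f = 0 -> h * g = 0.
Proof.
move=> gf hf0; apply/cts_eqP => x; rewrite ctsM /=.
have [->|gx0] := eqVneq (g x) 0; first by rewrite mulr0.
rewrite (mul_eq0_support hf0) ?mul0r//; apply: gf.
by apply: subset_closure => /= gx; rewrite gx eqxx in gx0.
Qed.

(** If [g x] is nonzero at some [x] outside the support of [f], complete regularity gives [u] equal
    to 0 at [x] and 1 on that support. Then [1 - u] annihilates [f] but not [g]. *)
Lemma ann_sub_support f g : completely_regular_space X ->
  (forall h, h * f = 0 -> h * g = 0) -> support g `<=` support f.
Proof.
move=> crX annfg; rewrite /support.
(* As the support of [f] is closed, it suffices to treat points where [g] is nonzero. *)
rewrite [X in _ `<=` X]((closure_id _).1 (@closed_closure _ _)).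
apply: closure_subset => x /= gx0; apply: contrapT => nfx.
have /(@uniform_separatorP _ R)[u [cu _ ux0 u1]] :=
  crX x _ (@closed_closure _ _) nfx.
have [w wE] : exists w : continuousType X R, forall y, w y = 1 - u y.
  by exists (1 - cts_Sub (mem_set cu : u \in @cts_pred X R)).
have /annfg/cts_eqP/(_ x) : w * f = 0.
  apply/cts_eqP => y; have [fy0|fy0] := eqVneq (f y) 0.
    by rewrite ctsM /= fy0 mulr0.
  have uy1 : u y = 1.
    by apply: u1; exists y => //; apply: subset_closure; exact/eqP.
  by rewrite ctsM /= wE uy1 subrr mul0r.
have uxE : u x = 0 by apply: ux0; exists x.
by rewrite ctsM /= wE uxE subr0 mul1r.
Qed.

Lemma minimal_primes_meet_support f g : completely_regular_space X ->
  minimal_primes_meet f g <-> support g `<=` support f.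
Proof.
move=> crX; rewrite minimal_primes_meetP; last exact: cts_reduced.
split=> [|gf h]; [exact: ann_sub_support|exact: sub_support_ann].
Qed.

Lemma supportD_sqr f g : support (f * f + g * g) = support f `|` support g.
Proof.
have fgE x : (f * f + g * g) x = f x ^+ 2 + g x ^+ 2 by [].
rewrite /support -closureU -setCI; congr (closure (~` _)).
apply/seteqP; split=> x; rewrite /zero_set /setI /mkset fgE.
  move=> /eqP; rewrite paddr_eq0 ?sqr_ge0// !sqrf_eq0.
  by move=> /andP[/eqP ? /eqP ?].
by move=> [-> ->]; rewrite expr0n addr0.
Qed.

End ContinuousFunctions.

Theorem theorem5p2 (R : realType) (X : topologicalType)
    (X_completely_regular : completely_regular_space X)
    (X_hausdorff : hausdorff_space X)
    (I : set (continuousType X R)) (I_proper : is_proper_ideal I) :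
  is_z_circ_ideal I <->
  exists P : set (set X), is_closed_set_ideal P /\ I = supported_in P.
Proof.
split=> [[[I0 ID IM] Iz]|[P [[_ _ Psub] IE]]]; last first.
  split=> [|f]; first exact: I_proper.1.
  rewrite IE => Pf g /(minimal_primes_meet_support _ _ X_completely_regular) gf.
  exact: Psub Pf gf (@closed_closure _ _).
exists [set B | closed B /\ exists2 f, I f & B `<=` support f]; split.
  split=> [B []//|B C [cB [f If Bf]] [cC [g Ig Cg]]|B C [_ [f If Bf]] CB cC].
    split; first exact: closedU.
    (* Squares rule out the cancellation that could shrink the support of [f + g]. *)
    exists (f * f + g * g); first by apply: ID; exact: IM.
    by rewrite supportD_sqr; exact: setUSS.
  by split=> //; exists f => //; exact: subset_trans Bf.
apply/seteqP; split=> [f If|g [_ [f If gf]]].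
  by split; [exact: closed_closure|exists f].
(* The support inclusion puts [g] in every minimal prime containing [f], and the z-circ property
   then puts it in [I]. *)
by apply: (Iz f If); apply/minimal_primes_meet_support.
Qed.
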